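(* Let $G$ be a finite abelian group of even order $n$, let $S\subseteq G$ with $S=-S$ and $0\notin S$, and let $\Gamma=\mathrm{Cay}(G,S)$. Let $\alpha,\beta$ be nonzero complex numbers, let $x\neq y$ be vertices and $t\in\mathbb{R}$. Then $\Gamma$ has $(\alpha,\beta)$-fractional revival from $x$ to $y$ at time $t$ if and only if all of the following hold: (1) $a=x-y$ has order two in $G$; (2) $\Gamma$ is an integral graph; (3) $e^{\imath t\lambda_g}=\alpha+\beta$ for every $g\in G_0$ and $e^{\imath t\lambda_g}=\alpha-\beta$ for every $g\in G_1$, where $G_0=\{g\in G:\chi_a(g)=1\}$ and $G_1=\{g\in G:\chi_a(g)=-1\}$.
   Context: $\mathrm{Cay}(G,S)$ has vertex set $G$, with $u,v$ adjacent iff $u-v\in S$; $A$ is its adjacency matrix and $H(t)=\exp(\imath tA)$. For distinct vertices $x,y$, the graph has $(\alpha,\beta)$-fractional revival from $x$ to $y$ at time $t$ if $H(t)\mathbf{e}_x=\alpha\mathbf{e}_x+\beta\mathbf{e}_y$ with $\beta\neq0$ and $|\alpha|^2+|\beta|^2=1$. Write $G=\mathbb{Z}_{n_1}\oplus\cdots\oplus\mathbb{Z}_{n_r}$; for $x=(x_1,\dots,x_r)\in G$ the character $\chi_x$ is $\chi_x(g)=\prod_{s=1}^r e^{2\pi\imath x_sg_s/n_s}$ (so $\chi_x(g)=\chi_g(x)$). The eigenvalues of $A$ are $\lambda_g=\sum_{s\in S}\chi_g(s)$, $g\in G$. The graph is integral if all $\lambda_g$ are integers. *)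

(* Defs.v *)
From HB Require Import structures.
From mathcomp Require Import all_boot all_order all_algebra.
From mathcomp Require Import all_classical all_reals all_analysis.
From mathcomp Require Import complex.
Set Implicit Arguments.
Unset Strict Implicit.
Unset Printing Implicit Defensive.
Import Order.TTheory GRing.Theory Num.Theory.
Import numFieldTopology.Exports numFieldNormedType.Exports.
Local Open Scope ring_scope.

(* The complex numbers over a real type R, viewed as a numClosedFieldType so
   that the generic topology of numFieldTypes applies (limits of sequences). *)
Definition Cplx (R : realType) : numClosedFieldType := R[i].

Definition cexp (R : realType) (z : Cplx R) : Cplx R :=
  limn (fun N : nat => \sum_(k < N) z ^+ k / (k`!)%:R).

Definition mexp (R : realType) (m : nat) (M : 'M[Cplx R]_m) : 'M[Cplx R]_m :=
  \matrix_(i, j) limn (fun N : nat => (\sum_(k < N) (k`!)%:R^-1 *: M ^+ k) i j).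

(* The group G = Z_{m_1} (+) ... (+) Z_{m_r}, with moduli m_s = (n s).+1 >= 1. *)
Definition grp (r : nat) (n : 'I_r -> nat) : finType :=
  {dffun forall s : 'I_r, 'I_(n s).+1}.

Section Group.
Variables (r : nat) (n : 'I_r -> nat).
Definition gzero : grp n := [ffun s => (0 : 'I_(n s).+1)%R].
Definition gadd (u v : grp n) : grp n := [ffun s => (u s + v s : 'I_(n s).+1)%R].
Definition gopp (u : grp n) : grp n := [ffun s => (- u s : 'I_(n s).+1)%R].
Definition gsub (u v : grp n) : grp n := gadd u (gopp v).

Definition order_two (a : grp n) : Prop := a <> gzero /\ gadd a a = gzero.

Definition chi (R : realType) (x g : grp n) : Cplx R :=
  \prod_(s < r) cexp ('i * ((2 * pi)%:C)%C * ((x s * g s)%:R / (n s).+1%:R)).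

Definition cay_adj (R : realType) (S : {set grp n}) : 'M[Cplx R]_#|grp n| :=
  \matrix_(i, j) (gsub (enum_val i) (enum_val j) \in S)%:R.

Definition transH (R : realType) (S : {set grp n}) (t : R) : 'M[Cplx R]_#|grp n| :=
  mexp (('i * (t%:C)%C) *: cay_adj R S).

Definition evec (R : realType) (x : grp n) : 'cV[Cplx R]_#|grp n| :=
  delta_mx (enum_rank x) ord0.

Definition eigval (R : realType) (S : {set grp n}) (g : grp n) : Cplx R :=
  \sum_(s in S) chi R g s.

Definition integral_graph (R : realType) (S : {set grp n}) : Prop :=
  forall g : grp n, exists z : int, eigval R S g = z%:~R.

Definition frac_revival (R : realType) (S : {set grp n}) (alpha beta : Cplx R)
    (x y : grp n) (t : R) : Prop :=
  x <> y /\
  transH S t *m evec R x = alpha *: evec R x + beta *: evec R y /\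
  beta <> 0 /\ `|alpha| ^+ 2 + `|beta| ^+ 2 = 1.
End Group.

(* Main.v *)
(* The characters chi_g are left eigenvectors of A, so the matrix of characters
   diagonalizes exp(itA); reading H(t) e_x = alpha e_x + beta e_y in this basis
   turns it into e^{it lambda_g} = alpha + beta / chi_a(g) for all g, with
   a = x - y.  As lambda_g is real, |alpha + beta / chi_a(g)| = 1; together with
   the case g = 0 and |alpha|^2 + |beta|^2 = 1 this makes chi_a(g) real, hence
   equal to 1 or -1, so a has order two.  For integrality, t (lambda_g - lambda_h)
   lies in 2 pi Z whenever chi_a(g) = chi_a(h), while the sum of the lambda_g over
   each of the two classes is rational by orthogonality.  Summing the differences
   to lambda_0 over the class of 0 shows that 2 pi / t is rational, unless S is
   contained in {0, a}; hence every lambda_g is rational, and being an algebraic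
   integer it is an integer. *)
Require Import Defs.
From HB Require Import structures.
From mathcomp Require Import all_boot all_order all_algebra all_field.
From mathcomp Require Import all_classical all_reals all_analysis.
From mathcomp Require Import complex.
From mathcomp Require Import ring lra.
Import Order.TTheory GRing.Theory Num.Theory.
Import numFieldTopology.Exports numFieldNormedType.Exports.
Local Open Scope ring_scope.

(** * The exponential of an imaginary number *)

(** A closed form to compute with, whereas [cexp] is a limit of partial sums; [cexp_im] identifies
    the two on the imaginary axis. *)
Definition expi {R : realType} (x : R) : Cplx R := (cos x +i* sin x)%C.

Lemma expiD {R : realType} (x y : R) : expi (x + y) = expi x * expi y.
Proof.
rewrite /expi cosD sinD; apply/eqP; rewrite eq_complex /=; apply/andP; split=> //.
by rewrite addrC.
Qed.

Lemma expi0 {R : realType} : expi (0 : R) = 1.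
Proof. by rewrite /expi cos0 sin0. Qed.

Lemma expiMn {R : realType} (x : R) k : expi (x *+ k) = expi x ^+ k.
Proof.
elim: k => [|k IH]; first by rewrite mulr0n expi0 expr0.
by rewrite mulrS expiD IH exprS.
Qed.

Lemma norm_expi {R : realType} (x : R) : `|expi x| = 1.
Proof. by rewrite normc_def /= cos2Dsin2 sqrtr1. Qed.

(** Reduce [x] modulo [2 * pi] to [y] in [0, 2 pi). If [y] were nonzero, then [sin (y / 2) > 0], and
    cos y = 1 - 2 sin^2 (y / 2) would be less than 1. *)
Lemma expi_eq1 {R : realType} (x : R) :
  expi x = 1 -> exists z : int, x = 2 * pi * z%:~R.
Proof.
move=> [cosx1 sinx0].
have pi0 := pi_gt0 R.
pose z := Num.floor (x / (2 * pi)).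
pose y := x - 2 * pi * z%:~R.
have per (u : R) (m : int) : cos (u + 2 * pi * m%:~R) = cos u.
  have pern v k : cos (v + (2 * pi) * k%:R) = cos v :> R.
    have -> : 2 * pi * k%:R = (pi *+ 2) *+ k :> R.
      by rewrite -mulrA mulr_natl mulr_natr mulrnAC.
    exact: (periodicn (@cosD2pi R)).
  case: m => k; first exact: pern.
  rewrite -(pern (u + _) k.+1); congr cos.
  by rewrite NegzE mulrNz; ring.
have cosy : cos y = 1 by rewrite -(per y z) /y subrK.
have y0 : 0 <= y.
  rewrite /y subr_ge0 -ler_pdivlMl; last by lra.
  by rewrite mulrC floor_le.
have y2 : y < 2 * pi.
  have : x / (2 * pi) < (z + 1)%:~R by rewrite floorD1_gt.
  rewrite ltr_pdivrMr ?intrD /y; last by lra.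
  by move=> h; rewrite ltrBlDr; apply: lt_le_trans h _; rewrite mulrDl mulrC; lra.
have [y0'|y0'] := eqVneq y 0; first by exists z; move: y0'; rewrite /y => /subr0_eq.
have ygt : 0 < y by rewrite lt_neqAle eq_sym y0'.
have : 0 < sin (y / 2) by apply: sin_gt0_pi; lra.
have : cos y = 1 - sin (y/2) ^+ 2 *+ 2.
  have {1}-> : y = (y / 2) *+ 2 by rewrite -mulr_natr divfK // pnatr_eq0.
  by rewrite cos_mulr2n cos2sin2; ring.
by rewrite cosy; nra.
Qed.

Lemma exp_partial_sum {R : realType} (x : R) N :
  \sum_(k < N) ('i * (x%:C)%C) ^+ k / (k`!)%:R =
  (series (cos_coeff x) N +i* series (sin_coeff x) N)%C :> Cplx R.
Proof.
rewrite /series /= !big_mkord; elim: N => [|N IH]; first by rewrite !big_ord0.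
rewrite !big_ord_recr /= IH.
suff -> : ('i * (x%:C)%C) ^+ N / (N`!)%:R =
    (cos_coeff x N +i* sin_coeff x N)%C :> Cplx R by [].
have -> : ('i * (x%:C)%C) ^+ N / (N`!)%:R =
    ('i)%C ^+ N * ((x ^+ N / N`!%:R)%:C)%C :> Cplx R.
  by rewrite exprMn -mulrA rmorphM rmorphXn fmorphV rmorph_nat.
(* This is the shape of [cos_coeff] and [sin_coeff]; for even [N] the exponent [N.-1./2] is
   meaningless, but its factor [(odd N)%:R] is then 0. *)
have -> : ('i)%C ^+ N = (((~~ odd N)%:R * (-1) ^+ N./2) +i*
    ((odd N)%:R * (-1) ^+ N.-1./2))%C :> R[i].
  rewrite -[in LHS](odd_double_half N) exprD -mul2n exprM sqr_i.
  have -> : (-1) ^+ N./2 = (((-1) ^+ N./2)%:C)%C :> R[i].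
    by rewrite rmorphXn rmorphN1.
  have [oN|eN] := boolP (odd N).
    have -> : N.-1./2 = N./2 by rewrite -[in LHS](odd_double_half N) oN /= doubleK.
    rewrite /= expr1.
    by apply/eqP; rewrite eq_complex /=; apply/andP; split; apply/eqP; ring.
  by apply/eqP; rewrite eq_complex /=; apply/andP; split; apply/eqP; ring.
rewrite /cos_coeff /sin_coeff /= -exprnP.
by apply/eqP; rewrite eq_complex /=; apply/andP; split; apply/eqP; ring.
Qed.

Lemma cvg_Cplx {R : realType} (u v : nat -> R) (a b : R) :
  (u @ \oo --> a)%classic -> (v @ \oo --> b)%classic ->
  ((fun n => (u n +i* v n)%C : Cplx R) @ \oo --> ((a +i* b)%C : Cplx R))%classic.
Proof.
move=> ua vb; apply/cvgrPdist_lt => e e0.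
(* In the partial order of [R[i]], positivity of [e] forces its imaginary part to vanish, so a bound
   of half the real part on each coordinate suffices. *)
have [re0 r0] : e = ((complex.Re e)%:C)%C /\ 0 < complex.Re e.
  by move: e0; rewrite ltcE /= => /andP[/eqP ime ->]; case: e ime => ? ? /= ->.
have r20 : 0 < complex.Re e / 2 by rewrite divr_gt0.
move/cvgrPdist_lt : ua => /(_ _ r20) ua; move/cvgrPdist_lt : vb => /(_ _ r20) vb.
near=> n; rewrite re0 normc_def /= ltcR.
have : `|a - u n| < complex.Re e / 2 by near: n.
have : `|b - v n| < complex.Re e / 2 by near: n.
rewrite !ltr_norml => /andP[h1 h2] /andP[h3 h4].
rewrite -[ltRHS]ger0_norm ?ltW// -sqrtr_sqr ltr_sqrt; first by nra.
by rewrite exprn_gt0.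
Unshelve. all: by end_near.
Qed.

Lemma cvg_cexp {R : realType} (x : R) :
  ((fun N : nat => \sum_(k < N) ('i * (x%:C)%C) ^+ k / (k`!)%:R : Cplx R) @ \oo
    --> expi x)%classic.
Proof.
under eq_fun do rewrite exp_partial_sum.
apply: cvg_Cplx.
- by rewrite cos.unlock; exact: is_cvg_series_cos_coeff.
- by rewrite sin.unlock; exact: is_cvg_series_sin_coeff.
Qed.

Lemma cexp_im {R : realType} (x : R) : cexp ('i * (x%:C)%C) = expi x.
Proof. exact/cvg_lim/cvg_cexp/norm_hausdorff. Qed.

(** * Characters *)

Section GroupLaws.
Context {r : nat} {n : 'I_r -> nat}.
Implicit Types u v : grp n.

Lemma gsub_addK u v : gsub (gadd u v) v = u.
Proof. by apply/ffunP => s; rewrite !ffunE addrK. Qed.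

Lemma gadd_inj v : injective (fun u => gadd u v).
Proof. by apply: (can_inj (g := fun u => gsub u v)) => u; exact: gsub_addK. Qed.

Lemma gaddg0 u : gadd u (gzero n) = u.
Proof. by apply/ffunP => s; rewrite !ffunE addr0. Qed.

Lemma gsubuu u : gsub u u = gzero n.
Proof. by apply/ffunP => s; rewrite !ffunE subrr. Qed.

Lemma gsub_eq0 u v : gsub u v = gzero n -> u = v.
Proof.
move/ffunP=> h; apply/ffunP => s; have := h s; rewrite !ffunE.
exact: subr0_eq.
Qed.

Lemma goppK : involutive (@gopp r n).
Proof. by move=> u; apply/ffunP => s; rewrite !ffunE opprK. Qed.

Lemma gadd_opp u : gadd u (gopp u) = gzero n.
Proof. by apply/ffunP => s; rewrite !ffunE subrr. Qed.

End GroupLaws.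

Section Characters.
Context {R : realType} {r : nat} {n : 'I_r -> nat}.
Implicit Types x g h : grp n.

Definition root1 (m : nat) : Cplx R := expi (2 * pi / m.+1%:R).

Lemma root1X m : root1 m ^+ m.+1 = 1.
Proof.
rewrite /root1 -expiMn -[X in expi X]mulr_natr divfK ?pnatr_eq0//.
by rewrite /expi mulr_natl cos2pi sin2pi.
Qed.

Lemma root1_mod m k : root1 m ^+ (k %% m.+1) = root1 m ^+ k.
Proof.
by rewrite [in RHS](divn_eq k m.+1) exprD mulnC exprM root1X expr1n mul1r.
Qed.

(** Primitivity of the root of unity: by [expi_eq1], [k] is an integer multiple of [m.+1], and the
    bound leaves only 0. *)
Lemma root1_eq1 m k : (k < m.+1)%N -> root1 m ^+ k = 1 -> k = 0%N.
Proof.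
move=> km; rewrite /root1 -expiMn => /expi_eq1 [z].
have pi0 := pi_gt0 R.
have e2 : 2 * pi != 0 :> R by rewrite mulf_neq0 ?gt_eqF// pnatr_eq0.
rewrite -[X in X = _]mulr_natr -!mulrA => /(mulfI _); rewrite pnatr_eq0 => /(_ isT).
move/(mulfI _); rewrite gt_eqF// => /(_ isT) => hz.
have {}hz : k%:R = z%:~R * m.+1%:R :> R.
  by rewrite -hz mulrAC mulVf ?mul1r// pnatr_eq0.
have {}hz : Posz k = z * Posz m.+1.
  by apply: (@intr_inj R); rewrite intrM; exact: hz.
have : (m.+1 %| k)%N by rewrite -[k]/(absz k) hz abszM dvdn_mull.
case: k km {hz} => [//|k] km /(dvdn_leq (ltn0Sn k)) h.
by move: (leq_trans km h); rewrite ltnn.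
Qed.

Lemma chiE x g : chi R x g = \prod_(s < r) root1 (n s) ^+ (x s * g s).
Proof.
rewrite /chi; apply: eq_bigr => s _; rewrite /root1 -expiMn -cexp_im.
congr cexp; rewrite -mulrA; congr (_ * _).
rewrite -(mulr_natr (2 * pi / _)) !(rmorphM (real_complex R)).
by rewrite (fmorphV (real_complex R)) !(rmorph_nat (real_complex R)) mulrA mulrAC.
Qed.

Lemma chiC x g : chi R x g = chi R g x.
Proof. by rewrite !chiE; apply: eq_bigr => s _; rewrite mulnC. Qed.

Lemma chiD x g h : chi R x (gadd g h) = chi R x g * chi R x h.
Proof.
rewrite !chiE -big_split /=; apply: eq_bigr => s _.
by rewrite ffunE /= -exprD -mulnDr -root1_mod modnMmr root1_mod.
Qed.

Lemma chi0 x : chi R x (gzero n) = 1.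
Proof. by rewrite chiE big1// => s _; rewrite ffunE muln0 expr0. Qed.

Lemma norm_chi x g : `|chi R x g| = 1.
Proof.
rewrite chiE normr_prod big1// => s _.
by rewrite normrX norm_expi expr1n.
Qed.

Lemma chi_neq0 x g : chi R x g != 0.
Proof. by rewrite -normr_eq0 norm_chi oner_eq0. Qed.

Lemma chiN x g : chi R x (gopp g) = (chi R x g)^-1.
Proof.
apply: (mulfI (chi_neq0 x g)); rewrite -chiD gadd_opp chi0 divff//.
exact: chi_neq0.
Qed.

Lemma chiB x g h : chi R x (gsub g h) = chi R x g / chi R x h.
Proof. by rewrite chiD chiN. Qed.

Lemma chiBl g h x : chi R (gsub g h) x = chi R g x / chi R h x.
Proof. by rewrite chiC chiB (chiC x g) (chiC x h). Qed.

Lemma chi_eq1 x : (forall g, chi R x g = 1) -> x = gzero n.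
Proof.
move=> x1; apply/ffunP => s; rewrite ffunE.
(* Evaluating at the generator of the [s]-th summand leaves the single factor
   [root1 (n s) ^+ x s]. *)
have := x1 [ffun s' => if s' == s then inord 1 else 0].
rewrite chiE (bigD1 s)//= big1 => [|s' ne]; last first.
  by rewrite ffunE (negPf ne) muln0.
rewrite ffunE eqxx mulr1 => h; apply/val_inj => /=.
(* In a trivial summand [inord 1] falls back to 0, so this case is settled by [x s < 1] instead. *)
have [m0|m0] := posnP (n s).
  have : ((n s).+1 <= 1)%N by rewrite m0.
  by move/(leq_trans (ltn_ord (x s))); rewrite ltnS leqn0 => /eqP.
apply: (root1_eq1 _ _ (ltn_ord (x s))).
by rewrite -[RHS]h inordK ?muln1.
Qed.

(** For a nontrivial character pick [h] with [chi R x h != 1]: translation by [h] multiplies the sum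
    by this value, yet only permutes its terms. *)
Lemma sum_chi x : \sum_g chi R x g = ((x == gzero n) * #|grp n|)%:R.
Proof.
have [->|x0] := eqVneq.
  rewrite mul1n -sum1_card natr_sum; apply: eq_bigr => g _.
  by rewrite chiC chi0.
have [h h1] : exists h, chi R x h != 1.
  apply: contrapT => nh; case/eqP: x0; apply: chi_eq1 => g.
  by apply/eqP/negPn/negP => h; apply: nh; exists g.
have : (chi R x h - 1) * \sum_g chi R x g = 0.
  rewrite mulrBl mul1r mulr_sumr; apply/eqP; rewrite subr_eq0; apply/eqP.
  rewrite [RHS](reindex_inj (gadd_inj h)) /=.
  by apply: eq_bigr => g _; rewrite chiD; exact: mulrC.
by move/eqP; rewrite mulf_eq0 subr_eq0 (negPf h1) => /eqP.
Qed.

End Characters.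

(** * Diagonalization of the adjacency matrix by characters *)

Section Eigen.
Context {R : realType} {r : nat} {n : 'I_r -> nat} (S : {set grp n}).

Definition chi_mx : 'M[Cplx R]_#|grp n| :=
  \matrix_(i, j) chi R (enum_val i) (enum_val j).

(** The conjugate transpose of [chi_mx] divided by the group order: inverses of values are their
    conjugates, and [chi_mx] is symmetric by [chiC]. *)
Definition chi_mxV : 'M[Cplx R]_#|grp n| :=
  \matrix_(i, j) ((chi R (enum_val i) (enum_val j))^-1 / #|grp n|%:R).

Lemma card_grp_neq0 : #|grp n|%:R != 0 :> Cplx R.
Proof.
by rewrite pnatr_eq0 -lt0n; apply/card_gt0P; exists (gzero n).
Qed.

Lemma big_ord_enum_val (T : finType) (F : T -> Cplx R) :
  \sum_(i < #|T|) F (enum_val i) = \sum_z F z.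
Proof. by rewrite (big_enum_val (A := T)). Qed.

Lemma chi_mx_mulV : chi_mx *m chi_mxV = 1%:M.
Proof.
apply/matrixP => i j; rewrite !mxE.
transitivity (\sum_z chi R (gsub (enum_val i) (enum_val j)) z / #|grp n|%:R).
  rewrite -[RHS]big_ord_enum_val; apply: eq_bigr => k _.
  by rewrite mxE mxE chiBl (chiC (enum_val k) (enum_val j)) mulrA.
rewrite -mulr_suml sum_chi; have [->|ij] := eqVneq i j.
  by rewrite gsubuu eqxx mul1n divff ?card_grp_neq0.
rewrite (_ : _ == _ = false) ?mul0n ?mul0r//; apply/negbTE.
by apply: contra ij => /eqP/gsub_eq0/enum_val_inj ->.
Qed.

Lemma chi_mxV_mul : chi_mxV *m chi_mx = 1%:M.
Proof. exact/mulmx1C/chi_mx_mulV. Qed.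

(** Shifting the summation variable by the column index [v] pulls out the factor chi(v) and leaves
    the sum of the character over [S]. *)
Lemma mul_chi_adj :
  chi_mx *m cay_adj R S = diag_mx (\row_i eigval R S (enum_val i)) *m chi_mx.
Proof.
apply/matrixP => i j; rewrite mul_diag_mx !mxE.
transitivity (\sum_z chi R (enum_val i) z * (gsub z (enum_val j) \in S)%:R).
  by rewrite -[RHS]big_ord_enum_val; apply: eq_bigr => k _; rewrite !mxE.
rewrite (reindex_inj (gadd_inj (enum_val j))) /= /eigval mulr_suml.
rewrite [RHS]big_mkcond; apply: eq_bigr => z _.
by rewrite gsub_addK chiD; case: (z \in S); rewrite ?mulr1 ?mulr0.
Qed.

Hypothesis Ssym : forall s, s \in S -> gopp s \in S.

Lemma chi_conj (x g : grp n) : ((chi R x g)^*)%C = chi R x (gopp g).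
Proof.
rewrite chiN; apply: (mulfI (chi_neq0 x g)); rewrite divff ?chi_neq0//.
by rewrite -sqr_normc norm_chi expr1n.
Qed.

(** Conjugation turns the term of [s] into the term of its opposite, which permutes [S] by
    [Ssym]. *)
Lemma eigval_real g : eigval R S g = ((complex.Re (eigval R S g))%:C)%C.
Proof.
suff : ((eigval R S g)^*)%C = eigval R S g.
  case: (eigval R S g) => a b [] /eqP.
  by rewrite eq_sym -addr_eq0 -mulr2n mulrn_eq0 /= => /eqP ->.
rewrite /eigval (rmorph_sum (@conjc R)).
rewrite [RHS](reindex_inj (inv_inj goppK)) /=.
apply: eq_big => [s|s _]; last exact: chi_conj.
by apply/idP/idP => [/Ssym|/Ssym]; rewrite ?goppK.
Qed.

End Eigen.

(** Each entry of a partial sum for [M] is a fixed finite combination of the scalar partial sums for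
    the [mu i], so the limit passes through. The convergence hypothesis makes each [cexp (mu i)] a
    true limit, not a default value. *)
Lemma mul_mexp {R : realType} m (M V W : 'M[Cplx R]_m) (mu : 'I_m -> Cplx R) :
  V *m W = 1%:M -> V *m M = diag_mx (\row_i mu i) *m V ->
  (forall i, cvgn (fun N : nat => \sum_(k < N) mu i ^+ k / (k`!)%:R)) ->
  V *m mexp M = diag_mx (\row_i cexp (mu i)) *m V.
Proof.
move=> VW VM mu_cvg; have WV := mulmx1C VW.
have VMk k : V *m M ^+ k = diag_mx (\row_i mu i) ^+ k *m V.
  elim: k => [|k IH]; first by rewrite !expr0 mul1mx mulmx1.
  rewrite exprSr -[M ^+ k * M]/(M ^+ k *m M) mulmxA IH -mulmxA VM mulmxA.
  by rewrite [in RHS]exprSr.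
have diagk k : diag_mx (\row_i mu i) ^+ k = diag_mx (\row_i mu i ^+ k).
  elim: k => [|k IH]; first by apply/matrixP => i j; rewrite expr0 !mxE.
  rewrite exprS IH -[LHS]/(_ *m _) mulmx_diag; congr diag_mx.
  by apply/rowP => i; rewrite !mxE exprS.
suff -> : mexp M = W *m diag_mx (\row_i cexp (mu i)) *m V.
  by rewrite !mulmxA VW mul1mx.
apply/matrixP => i j; rewrite mxE.
apply/cvg_lim; first exact: norm_hausdorff.
have -> : (fun N => (\sum_(k < N) (k`!)%:R^-1 *: M ^+ k) i j) =
    (fun N : nat => \sum_l W i l * V l j * \sum_(k < N) mu l ^+ k / (k`!)%:R).
  apply/funext => N.
  have -> : \sum_(k < N) (k`!)%:R^-1 *: M ^+ k =
      W *m diag_mx (\row_l \sum_(k < N) mu l ^+ k / (k`!)%:R) *m V.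
    rewrite -[LHS]mul1mx -WV -!mulmxA; congr (_ *m _).
    rewrite mulmx_sumr; under eq_bigr do rewrite -scalemxAr VMk diagk scalemxAl.
    rewrite -mulmx_suml; congr (_ *m _).
    apply/matrixP => a b; rewrite summxE !mxE -sumrMnl; apply: eq_bigr => k _.
    by rewrite !mxE mulrnAr mulrC.
  rewrite -mulmxA mxE; apply: eq_bigr => l _.
  by rewrite mul_diag_mx !mxE mulrCA mulrC -mulrA.
rewrite -mulmxA mxE.
have -> : \sum_l W i l * (diag_mx (\row_l cexp (mu l)) *m V) l j =
  \sum_l W i l * V l j * cexp (mu l).
  apply: eq_bigr => l _; rewrite mul_diag_mx !mxE -mulrA; congr (_ * _).
  exact: mulrC.
apply: cvg_big => [|l _].
  exact: (@add_continuous (Cplx R : pseudoMetricNormedZmodType _)).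
by apply: cvgM; [exact: cvg_cst|exact: mu_cvg].
Qed.

(** * Revival in the basis of characters *)

Section Transition.
Context {R : realType} {r : nat} {n : 'I_r -> nat} (S : {set grp n}).
Hypothesis Ssym : forall s, s \in S -> gopp s \in S.

Lemma cexp_eigval (t : R) g :
  cexp ('i * (t%:C)%C * eigval R S g) = expi (t * complex.Re (eigval R S g)).
Proof.
rewrite -cexp_im (eigval_real _ Ssym); congr cexp.
by rewrite (rmorphM (real_complex R)) mulrA.
Qed.

Lemma mul_chi_transH (t : R) :
  chi_mx *m transH S t =
  diag_mx (\row_i cexp ('i * (t%:C)%C * eigval R S (enum_val i))) *m chi_mx.
Proof.
apply: (mul_mexp _ _ _ _ _ chi_mx_mulV) => [|i].
  rewrite -scalemxAr mul_chi_adj scalemxAl; congr (_ *m _).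
  by apply/matrixP => i j; rewrite !mxE mulrnAr.
rewrite (eigval_real _ Ssym) -mulrA -(rmorphM (real_complex R)).
by apply/cvg_ex; eexists; exact: cvg_cexp.
Qed.

Lemma chi_evec (z g : grp n) :
  (chi_mx *m evec R z) (enum_rank g) ord0 = chi R g z.
Proof.
rewrite mxE (bigD1 (enum_rank z))//= big1 ?addr0 => [|k nk].
  by rewrite !mxE !eqxx mulr1 !enum_rankK.
by rewrite !mxE (negPf nk) mulr0.
Qed.

(** Multiplication by the invertible [chi_mx] loses nothing; in the coordinate of [g] both sides
    carry the nonzero factor [chi R g x], which is cancelled. *)
Lemma transH_evecP (alpha beta : Cplx R) (x y : grp n) (t : R) :
  transH S t *m evec R x = alpha *: evec R x + beta *: evec R y <->
  forall g, cexp ('i * (t%:C)%C * eigval R S g) =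
            alpha + beta / chi R (gsub x y) g.
Proof.
have chi_eq g : (chi_mx *m (transH S t *m evec R x)) (enum_rank g) ord0 =
    cexp ('i * (t%:C)%C * eigval R S g) * chi R g x.
  by rewrite mulmxA mul_chi_transH -mulmxA mul_diag_mx mxE chi_evec mxE enum_rankK.
have chi_eq2 g : (chi_mx *m (alpha *: evec R x + beta *: evec R y))
    (enum_rank g) ord0 = (alpha + beta / chi R (gsub x y) g) * chi R g x.
  rewrite mulmxDr -!scalemxAr mxE [X in X + _]mxE [X in _ + X]mxE !chi_evec.
  by rewrite chiBl (chiC x g) (chiC y g) invf_div mulrDl -mulrA divfK ?chi_neq0.
split=> [eqH g|eqH].
  by apply: (mulIf (chi_neq0 g x)); rewrite -chi_eq -chi_eq2 eqH.
rewrite -[LHS]mul1mx -[RHS]mul1mx -(chi_mxV_mul (R := R)) -!mulmxA.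
congr (_ *m _); apply/matrixP => i j.
by rewrite (ord1 j) -(enum_valK i) chi_eq chi_eq2 eqH.
Qed.

End Transition.

(** Put w = alpha conj(beta). Expanding the two unit moduli gives w + conj(w) = 0 and w conj(c) +
    conj(w) c = 0, hence w (conj(c) - c) = 0 with w nonzero: [c] is real of modulus 1. *)
Lemma unit_circle_real {R : realType} (alpha beta c : Cplx R) :
  alpha != 0 -> beta != 0 -> `|alpha| ^+ 2 + `|beta| ^+ 2 = 1 ->
  `|c| = 1 -> `|alpha + beta| = 1 -> `|alpha + beta * c| = 1 -> c ^+ 2 = 1.
Proof.
move=> a0 b0 ab1 c1 h1 hc.
have sq z : `|z| ^+ 2 = z * (z^*)%C :> Cplx R by exact: sqr_normc.
have cc : c * (c^*)%C = 1 by rewrite -sq c1 expr1n.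
have e1 : alpha * (beta^*)%C + beta * (alpha^*)%C = 0.
  have := sq (alpha + beta); rewrite h1 expr1n -ab1 !sq (rmorphD (@conjc R)).
  by move/eqP; rewrite eq_sym -subr_eq0 => /eqP <-; ring.
have e2 : alpha * (beta^*)%C * (c^*)%C + beta * (alpha^*)%C * c = 0.
  have := sq (alpha + beta * c).
  rewrite hc expr1n -ab1 !sq (rmorphD (@conjc R)) (rmorphM (@conjc R)).
  move/eqP; rewrite eq_sym -subr_eq0 => /eqP <-.
  have -> : beta * (beta^*)%C = beta * c * ((beta^*)%C * (c^*)%C).
    by rewrite mulrACA cc mulr1.
  by ring.
have : alpha * (beta^*)%C * (1 - c ^+ 2) = 0.
  transitivity (c * (alpha * (beta^*)%C * (c^*)%C + beta * (alpha^*)%C * c)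
    - c ^+ 2 * (alpha * (beta^*)%C + beta * (alpha^*)%C)
    + alpha * (beta^*)%C * (1 - c * (c^*)%C)); first by ring.
  by rewrite e1 e2 cc subrr !mulr0 subr0 addr0.
move/eqP; rewrite !mulf_eq0 (negPf a0) fmorph_eq0 (negPf b0) /= subr_eq0.
by move/eqP.
Qed.

(** * Integrality of the eigenvalues *)

(** The monic integer polynomial is carried from [K] through [rat] to [algC], where [Cint_rat_Aint]
    makes a rational algebraic integer an integer. *)
Lemma integral_rat_int {K : numFieldType} (q : rat) :
  integralOver (intr : int -> K) (ratr q) -> exists z : int, q = z%:~R.
Proof.
case=> p p_monic.
have -> : map_poly (intr : int -> K) p =
    map_poly ratr (map_poly (intr : int -> rat) p).
  by rewrite -map_poly_comp; apply: eq_map_poly => z /=; rewrite ratr_int.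
rewrite fmorph_root => /(rmorph_root (ratr : {rmorphism rat -> algC})).
rewrite -map_poly_comp => q_root.
have /Cint_rat_Aint h : (ratr q : algC) \in Aint.
  apply: root_monic_Aint q_root _ _.
    by rewrite monic_map.
  by apply/polyOverP => i; rewrite coef_map /= ratr_int intr_int.
have /intrP [z qz] := h (Crat_rat q).
exists z; apply: (fmorph_inj (ratr : {rmorphism rat -> algC})).
by rewrite /= ratr_int; exact: qz.
Qed.

Lemma integral_chi {R : realType} {r : nat} {n : 'I_r -> nat} (x g : grp n) :
  integralOver (intr : int -> Cplx R) (chi R x g).
Proof.
rewrite chiE; apply: (big_ind (fun z => integralOver (intr : int -> Cplx R) z)).
- exact: integral1.
- exact: integral_mul.
- move=> s _; exists ('X^((n s).+1) - 1); first exact: monicXnsubC.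
  rewrite /root rmorphB rmorph1 /= map_polyXn hornerD hornerN hornerXn hornerC.
  by rewrite -exprM mulnC exprM root1X expr1n subrr.
Qed.

Lemma integral_eigval {R : realType} {r : nat} {n : 'I_r -> nat}
    (S : {set grp n}) (g : grp n) :
  integralOver (intr : int -> Cplx R) (eigval R S g).
Proof.
rewrite /eigval; apply: (big_ind (fun z => integralOver (intr : int -> Cplx R) z)).
- exact: mxpoly.integral0.
- exact: integral_add.
- by move=> s _; exact: integral_chi.
Qed.

(** * Rationality from sums whose terms differ by multiples of a constant *)

Definition is_rat {K : numFieldType} (x : K) := exists q : rat, x = ratr q.

Section IsRat.
Context {K : numFieldType}.
Implicit Types x y : K.

Lemma is_ratD x y : is_rat x -> is_rat y -> is_rat (x + y).
Proof. by move=> [p ->] [q ->]; exists (p + q); rewrite rmorphD. Qed.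

Lemma is_ratM x y : is_rat x -> is_rat y -> is_rat (x * y).
Proof. by move=> [p ->] [q ->]; exists (p * q); rewrite rmorphM. Qed.

Lemma is_ratV x : is_rat x -> is_rat x^-1.
Proof. by move=> [p ->]; exists p^-1; rewrite fmorphV. Qed.

Lemma is_rat_int (z : int) : is_rat (z%:~R : K).
Proof. by exists z%:~R; rewrite ratr_int. Qed.

Lemma is_rat_nat (k : nat) : is_rat (k%:R : K).
Proof. exact: (is_rat_int k). Qed.

Lemma is_ratN x : is_rat x -> is_rat (- x).
Proof. by move=> [p ->]; exists (- p); rewrite rmorphN. Qed.

Lemma is_ratB x y : is_rat x -> is_rat y -> is_rat (x - y).
Proof. by move=> rx ry; apply/is_ratD/is_ratN. Qed.

End IsRat.

(** Subtracting the rational increments from the sum leaves [#|P|] copies of [l i0], so [l i0] is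
    rational, and then so is every other term. *)
Lemma is_rat_of_sum {K : numFieldType} {I : finType} (P : pred I)
    (l : I -> K) (c : K) (i0 : I) :
  is_rat c -> P i0 -> (forall i, P i -> exists z : int, l i - l i0 = c * z%:~R) ->
  is_rat (\sum_(i | P i) l i) -> forall i, P i -> is_rat (l i).
Proof.
move=> rc P0 lP rsum.
have r0 : is_rat (l i0).
  have -> : l i0 = (\sum_(i | P i) l i - \sum_(i | P i) (l i - l i0)) / #|P|%:R.
    rewrite -sumrB; under eq_bigr do rewrite subKr.
    rewrite sumr_const -[X in X / _]mulr_natr mulfK// pnatr_eq0 -lt0n.
    by apply/card_gt0P; exists i0.
  apply: is_ratM; last exact/is_ratV/is_rat_nat.
  apply: is_ratB => //; apply: big_ind; [exact: (is_rat_nat 0)|exact: is_ratD|].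
  by move=> i /lP [z ->]; apply/is_ratM/is_rat_int.
move=> i /lP [z e]; rewrite -(subrK (l i0) (l i)) e.
by apply: is_ratD => //; apply/is_ratM/is_rat_int.
Qed.

(** The total increment is [c] times an integer; it is rational, and the last hypothesis makes that
    integer nonzero, so one may divide by it. *)
Lemma is_rat_increment {K : numFieldType} {I : finType} (P : pred I)
    (l : I -> K) (c : K) (i0 : I) :
  (forall i, P i -> exists z : int, l i - l i0 = c * z%:~R) ->
  is_rat (\sum_(i | P i) l i) -> is_rat (l i0) ->
  \sum_(i | P i) l i <> #|P|%:R * l i0 -> is_rat c.
Proof.
move=> lP rsum r0 ne.
have [z hz] : exists z : int, \sum_(i | P i) (l i - l i0) = c * z%:~R.
  apply: (big_ind (fun x => exists z : int, x = c * z%:~R)) => //.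
    by exists 0; rewrite mulr0.
  by move=> _ _ [a ->] [b ->]; exists (a + b); rewrite intrD mulrDr.
move: hz; rewrite sumrB sumr_const -[X in _ - X]mulr_natl => hz.
have z0 : z%:~R != 0 :> K.
  apply/eqP => z0; apply: ne; apply/eqP; rewrite -subr_eq0 hz z0 mulr0//.
have -> : c = (\sum_(i | P i) l i - #|P|%:R * l i0) / z%:~R by rewrite hz mulfK.
apply: is_ratM; last exact/is_ratV/is_rat_int.
by apply: is_ratB => //; apply: is_ratM => //; exact: is_rat_nat.
Qed.

(** * Characters of elements of order two, and integrality from equal phases *)

Section OrderTwo.
Context {R : realType} {r : nat} {n : 'I_r -> nat} (a : grp n).

Lemma chi_sqr (g : grp n) : chi R a g ^+ 2 = chi R (gadd a a) g.
Proof. by rewrite (chiC (gadd a a)) chiD -(chiC a) expr2. Qed.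

Lemma chi_pm1 (g : grp n) : chi R a g ^+ 2 = 1 -> chi R a g = 1 \/ chi R a g = -1.
Proof. by move/eqP; rewrite sqrf_eq1 => /orP[/eqP ->|/eqP ->]; [left|right]. Qed.

Lemma chi_eqN1 : a <> gzero n -> (forall g, chi R a g ^+ 2 = 1) ->
  exists g, chi R a g = -1.
Proof.
move=> a0 a2; apply: contrapT => nex; apply/a0/(@chi_eq1 R) => g.
by case: (chi_pm1 g (a2 g)) => // h; case: nex; exists g.
Qed.

Hypothesis chi_a2 : forall g, chi R a g ^+ 2 = 1.

(* 1 + chi_a is twice the indicator function of the kernel of chi_a. *)
Lemma sum_chi_ker (s : grp n) :
  \sum_(g | chi R a g == 1) chi R s g =
  ((s == gzero n) + (gadd a s == gzero n))%:R * (#|grp n|%:R / 2).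
Proof.
have two0 : 2 != 0 :> Cplx R by rewrite pnatr_eq0.
apply: (mulfI two0); rewrite [RHS]mulrCA [2 * (_ / 2)]mulrC divfK//.
rewrite [in RHS]natrD [RHS]mulrDl -!natrM -!sum_chi -big_split /=.
rewrite mulr_sumr big_mkcond /=.
apply: eq_bigr => g _.
rewrite (chiC (gadd a s)) chiD -(chiC a) -(chiC s).
have [->|->] := chi_pm1 g (chi_a2 g).
  by rewrite eqxx mul1r mulr2n mulrDl !mul1r.
by rewrite eqNr oner_eq0 mulN1r subrr.
Qed.

End OrderTwo.

Lemma integral_graph_of_phases {R : realType} {r : nat} {n : 'I_r -> nat}
    (S : {set grp n}) (a : grp n) (t : R) :
  (forall s, s \in S -> gopp s \in S) ->
  a <> gzero n -> (forall g, chi R a g ^+ 2 = 1) -> t != 0 ->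
  (forall g h, chi R a g = chi R a h ->
     cexp ('i * (t%:C)%C * eigval R S g) = cexp ('i * (t%:C)%C * eigval R S h)) ->
  integral_graph R S.
Proof.
move=> Ssym a0 a2 t0 phase.
suff rat_eigval : forall g, is_rat (eigval R S g).
  move=> g; have [q qE] := rat_eigval g.
  have := integral_eigval (R := R) S g; rewrite qE => /integral_rat_int [z ->].
  by exists z; rewrite ratr_int.
(* Eigenvalues with equal phases differ by integer multiples of this spacing. *)
pose c : Cplx R := ((2 * pi / t)%:C)%C.
have diffE g h : chi R a g = chi R a h ->
    exists z : int, eigval R S g - eigval R S h = c * z%:~R.
  move=> agh.
  have eq_e := etrans (esym (cexp_eigval S Ssym t g))
    (etrans (phase g h agh) (cexp_eigval S Ssym t h)).
  have : expi (t * (complex.Re (eigval R S g) - complex.Re (eigval R S h))) = 1.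
    rewrite mulrBr expiD eq_e -expiD subrr; exact: expi0.
  move/expi_eq1 => [z zE]; exists z.
  rewrite (eigval_real S Ssym g) (eigval_real S Ssym h).
  rewrite -(rmorphB (real_complex R)) -(rmorph_int (real_complex R)).
  rewrite -(rmorphM (real_complex R)); congr (real_complex R).
  by rewrite mulrAC -zE mulrC mulKf.
have [g1 g1E] := chi_eqN1 a a0 a2.
pose P := [pred g : grp n | chi R a g == 1].
have P0 : P (gzero n) by rewrite /= chi0.
have NP g : ~~ P g -> chi R a g = -1.
  by move=> /eqP gN1; have [e|e] := chi_pm1 a g (a2 g); [case: (gN1 e)|exact: e].
have diffP g : P g -> exists z : int,
    eigval R S g - eigval R S (gzero n) = c * z%:~R.
  by move=> /eqP gE; apply: diffE; rewrite gE chi0.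
have diffNP g : ~~ P g -> exists z : int,
    eigval R S g - eigval R S g1 = c * z%:~R.
  by move=> /NP gE; apply: diffE; rewrite gE g1E.
have eigvalC g : eigval R S g = \sum_(s in S) chi R s g.
  by apply: eq_bigr => s _; exact: chiC.
have sumP : \sum_(g | P g) eigval R S g =
    \sum_(s in S) \sum_(g | P g) chi R s g.
  by under eq_bigr do rewrite eigvalC; exact: exchange_big.
have rat_sum (A : pred (grp n)) (F : grp n -> Cplx R) :
    (forall s, A s -> is_rat (F s)) -> is_rat (\sum_(s | A s) F s).
  move=> rF; apply: (big_ind is_rat) => //; [exact: (is_rat_nat 0)|exact: is_ratD].
have rat_ker s : is_rat (\sum_(g | P g) chi R s g).
  rewrite (sum_chi_ker a a2).
  by do ![exact: is_rat_nat|apply: is_ratM|apply: is_ratV].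
have rat_sumP : is_rat (\sum_(g | P g) eigval R S g).
  by rewrite sumP; apply: rat_sum.
have rat_sumNP : is_rat (\sum_(g | ~~ P g) eigval R S g).
  have -> : \sum_(g | ~~ P g) eigval R S g =
      \sum_g eigval R S g - \sum_(g | P g) eigval R S g.
    by rewrite [X in _ = X - _](bigID P) /= addrAC subrr add0r.
  apply: is_ratB => //.
  under eq_bigr do rewrite eigvalC.
  rewrite exchange_big /=; apply: rat_sum => s _; rewrite sum_chi.
  exact: is_rat_nat.
have eigval0 : eigval R S (gzero n) = #|S|%:R.
  by rewrite eigvalC -sum1_card natr_sum; apply: eq_bigr => s _; rewrite chi0.
have rat0 : is_rat (eigval R S (gzero n)) by rewrite eigval0; exact: is_rat_nat.
move=> g.
(* If the eigenvalues on the kernel [P] do not sum to [#|P|] times the one at 0, then [c] is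
   rational, and each class is handled from its base point, [gzero n] or [g1]. *)
have [eqS|neS] := pselect (\sum_(g | P g) eigval R S g =
  #|P|%:R * eigval R S (gzero n)); last first.
  have ratc : is_rat c := is_rat_increment P (eigval R S) c _ diffP rat_sumP rat0 neS.
  case: (boolP (P g)) => Pg.
    exact: (is_rat_of_sum P (eigval R S) c (gzero n) ratc P0 diffP rat_sumP g Pg).
  have NP1 : ~~ P g1 by rewrite /= g1E eqNr oner_eq0.
  exact: (is_rat_of_sum (fun h => ~~ P h) (eigval R S) c g1 ratc NP1 diffNP
    rat_sumNP g Pg).
(* In the equality case, every [s] in [S] will be shown to be 0 or the opposite of [a], so that
   [chi R s g] is 1 or the inverse of [chi R a g]. *)
rewrite eigvalC; apply: rat_sum => s sS.
have ratpm h : is_rat (chi R a h).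
  have [->|->] := chi_pm1 a h (a2 h); first exact: (is_rat_nat 1).
  exact: (is_rat_int (-1)).
have cardP : #|P|%:R = #|grp n|%:R / 2 :> Cplx R.
  have := sum_chi_ker a a2 (gzero n).
  rewrite eqxx gaddg0 (_ : (a == _) = false) ?mul1r; last exact/eqP.
  move=> <-; rewrite -sum1_card natr_sum; apply: eq_bigr => h _.
  by rewrite chiC chi0.
(* By [sum_chi_ker] the sum is 0 or [#|P|]: as [a] is nonzero, [u] and [gadd a u] are not both
   zero. *)
have le_ker u : \sum_(g | P g) chi R u g <= #|P|%:R.
  rewrite (sum_chi_ker a a2) cardP ger_pMl ?ler1n; last first.
    by rewrite divr_gt0// lt_neqAle eq_sym card_grp_neq0 ler0n.
  have [->|_] := eqVneq u (gzero n); last by case: eqP.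
  by rewrite gaddg0 (_ : (a == _) = false) //; exact/eqP.
(* Nonnegative deficits with sum 0 all vanish, so the kernel sum of [s] is [#|P|], not 0. *)
have sum0 : \sum_(u in S) (#|P|%:R - \sum_(g | P g) chi R u g) = 0.
  by rewrite sumrB -sumP eqS eigval0 sumr_const -[X in X - _]mulr_natr subrr.
have ge0 u : u \in S -> 0 <= #|P|%:R - \sum_(h | P h) chi R u h.
  by move=> _; rewrite subr_ge0.
have /eqP := psumr_eq0P ge0 sum0 sS.
have n2_neq0 : #|grp n|%:R / 2 != 0 :> Cplx R.
  by rewrite mulf_neq0 ?card_grp_neq0// invr_eq0 pnatr_eq0.
rewrite subr_eq0 (sum_chi_ker a a2) cardP.
have [-> _|_] := eqVneq s (gzero n).
  by rewrite chiC chi0; exact: (is_rat_nat 1).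
have [as0 _|_] := eqVneq (gadd a s) (gzero n).
  have : chi R a g * chi R s g = 1.
    by rewrite (chiC a) (chiC s) -chiD as0 chi0.
  move=> ags; have -> : chi R s g = (chi R a g)^-1.
    by apply: (mulfI (chi_neq0 a g)); rewrite ags divff ?chi_neq0.
  exact/is_ratV/ratpm.
by rewrite mul0r (negPf n2_neq0).
Qed.

(** In the converse direction this recovers the normalization of [alpha] and [beta] from the unit
    moduli of their sum and difference. *)
Lemma sqr_norm_parallelogram {R : realType} (u v : Cplx R) :
  `|u + v| ^+ 2 + `|u - v| ^+ 2 = (`|u| ^+ 2 + `|v| ^+ 2) *+ 2.
Proof.
rewrite !(sqr_normc (R := R)) (rmorphD (@conjc R)) (rmorphB (@conjc R)).
by ring.
Qed.

(** * The characterization of fractional revival *)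

Theorem theorem2p2 (R : realType) (r : nat) (n : 'I_r -> nat)
    (S : {set grp n})
    (Heven : ~~ odd #|grp n|)
    (Hsym : forall s, s \in S -> gopp s \in S)
    (H0 : gzero n \notin S)
    (alpha beta : Cplx R) (Halpha : alpha <> 0) (Hbeta : beta <> 0)
    (x y : grp n) (Hxy : x <> y) (t : R) :
  frac_revival S alpha beta x y t <->
  [/\ order_two (gsub x y),
      integral_graph R S &
      (forall g : grp n, chi R (gsub x y) g = 1 ->
          cexp ('i * (t%:C)%C * eigval R S g) = alpha + beta) /\
      (forall g : grp n, chi R (gsub x y) g = -1 ->
          cexp ('i * (t%:C)%C * eigval R S g) = alpha - beta)].
Proof.
have norm_cexp g : `|cexp ('i * (t%:C)%C * eigval R S g)| = 1.
  by rewrite (cexp_eigval _ Hsym) norm_expi.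
have := transH_evecP S Hsym alpha beta x y t.
have : gsub x y <> gzero n by move/gsub_eq0.
move: (gsub x y) => a a0 revivalP; split.
  move=> [_ [/revivalP {}revivalP [_ ab1]]].
  have e0 : cexp ('i * (t%:C)%C * eigval R S (gzero n)) = alpha + beta.
    by rewrite revivalP chi0 divr1.
  have a2 g : chi R a g ^+ 2 = 1.
    (* The number to be shown real is the inverse of [chi R a g], the factor of [beta] in
       [revivalP]. *)
    apply: invr_inj; rewrite invr1 -exprVn.
    apply: (unit_circle_real alpha beta) => //; try exact/eqP.
    - by rewrite normfV norm_chi invr1.
    - by rewrite -e0.
    - by rewrite -revivalP.
  have [g1 g1E] := chi_eqN1 a a0 a2.
  have eN1 g : chi R a g = -1 ->
      cexp ('i * (t%:C)%C * eigval R S g) = alpha - beta.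
    by move=> gE; rewrite revivalP gE invrN1 mulrN1.
  split.
  - split; first exact: a0.
    by apply: (@chi_eq1 R) => g; rewrite -chi_sqr.
  - apply: (integral_graph_of_phases S a t Hsym a0 a2) => [|g h gh].
      (* At time 0 all phases are 1; comparing those at 0 and [g1] gives alpha + beta = alpha -
         beta. *)
      apply/eqP => t0; apply: Hbeta.
      have phase1 g : cexp ('i * (t%:C)%C * eigval R S g) = 1.
        by rewrite (cexp_eigval S Hsym t g) t0 mul0r expi0.
      have /eqP := etrans (esym (etrans (esym (phase1 _)) e0))
        (etrans (esym (phase1 g1)) (eN1 g1 g1E)).
      rewrite -subr_eq0 opprD addrACA subrr add0r opprK -mulr2n mulrn_eq0.
      by move/eqP.
    have ab := congr1 (fun z => alpha + beta / z) gh.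
    exact: (etrans (revivalP g) (etrans ab (esym (revivalP h)))).
  - split=> g gE; last exact: eN1.
    by rewrite revivalP gE divr1.
move=> [[_ aa0] _ [e1 eN1]].
have a2 g : chi R a g ^+ 2 = 1 by rewrite chi_sqr aa0 chiC chi0.
split=> //; split; [|split=> //].
  apply/revivalP => g; have [gE|gE] := chi_pm1 a g (a2 g).
    by rewrite (e1 g gE) gE divr1.
  by rewrite (eN1 g gE) gE invrN1 mulrN1.
(* Since [a] is nonzero, the class where [chi R a] is -1 is inhabited, so the second phase condition
   yields the modulus of [alpha - beta]. *)
have [g1 g1E] := chi_eqN1 a a0 a2.
have norm_sum : `|alpha + beta| = 1 by rewrite -(e1 (gzero n) (chi0 a)).
have norm_diff : `|alpha - beta| = 1 by rewrite -(eN1 g1 g1E).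
have := sqr_norm_parallelogram alpha beta.
by rewrite norm_sum norm_diff expr1n -mulr2n => /eqP; rewrite eqrMn2r// => /eqP <-.
Qed.
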